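(* Let $n\ge4$, $\varphi\in S_n$, $I=\{1,\dots,n\}$ and $\mathcal M=\mathfrak{M}_{(n,\varphi)}$. The following conditions are equivalent: (i) there is a special decomposition of $\mathcal M$; (ii) $n=4$ and there is $X\subset I$ such that $|X|=2$ and $\varphi(X)=X$.
   Context: Let $n\ge 3$, $I=\{1,\dots,n\}$, $\varphi\in S_n$ a permutation of $I$, and let $A=\{a_1,\dots,a_n\}$, $B=\{b_1,\dots,b_n\}$ be disjoint $n$-element sets. For $i\in I$ put $A_i=(A\setminus\{a_i\})\cup\{b_i\}$ and $B_i=(B\setminus\{b_i\})\cup\{a_{\varphi(i)}\}$, $\mathcal L_A=\{A_i:i\in I\}$, $\mathcal L_B=\{B_i:i\in I\}$. The Möbius $n$-pair $\mathfrak{M}_{(n,\varphi)}$ is the point-block structure with point set $A\cup B$ and block set $\mathcal L_A\cup\mathcal L_B$. Its standard simplices are $S_A(\mathcal M)=\langle A,\mathcal L_A\rangle$ and $S_B(\mathcal M)=\langle B,\mathcal L_B\rangle$. A decomposition of $\mathcal M$ into two complementary, mutually inscribed simplices $S_1=\langle P_1,\mathcal K_1\rangle$, $S_2=\langle P_2,\mathcal K_2\rangle$ consists of a partition $P_1\sqcup P_2$ of the points into two $n$-sets and a partition $\mathcal K_1\sqcup\mathcal K_2$ of the blocks into two $n$-sets such that: for $t=1,2$ every point of $P_t$ lies on all but exactly one of the blocks in $\mathcal K_t$, and every block in $\mathcal K_t$ contains all but exactly one of the points of $P_t$; and for $s\ne t$ every point of $P_t$ lies on exactly one block of $\mathcal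 K_s$, and every block of $\mathcal K_t$ contains exactly one point of $P_s$. For $n\ge 4$, it is called a special decomposition if $S_t\neq S_A(\mathcal M)$ and $S_t\ne S_B(\mathcal M)$ for $t=1,2$. *)

(* Defs.v *)
From mathcomp Require Import all_boot all_fingroup.

Set Implicit Arguments.
Unset Strict Implicit.
Unset Printing Implicit Defensive.

(* Incidence is membership.  A block may contain elements outside [points]:
   the blocks of a simplex of a Moebius pair contain a point of the other one. *)
Record point_block (T : finType) := PointBlock {
  points : {set T};
  blocks : {set {set T}}
}.

Section MoebiusPair.

(* The index set I is 'I_n; a and b enumerate the sets A and B. *)
Variables (T : finType) (n : nat) (phi : 'S_n) (a b : 'I_n -> T).

Definition pointsA : {set T} := [set a i | i : 'I_n].
Definition pointsB : {set T} := [set b i | i : 'I_n].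

Definition blockA (i : 'I_n) : {set T} := (pointsA :\ a i) :|: [set b i].
Definition blockB (i : 'I_n) : {set T} := (pointsB :\ b i) :|: [set a (phi i)].

Definition blocksA : {set {set T}} := [set blockA i | i : 'I_n].
Definition blocksB : {set {set T}} := [set blockB i | i : 'I_n].

Definition simplexA : point_block T := PointBlock pointsA blocksA.
Definition simplexB : point_block T := PointBlock pointsB blocksB.

Definition moebius_pair : point_block T :=
  PointBlock (pointsA :|: pointsB) (blocksA :|: blocksB).

End MoebiusPair.

Section Decomposition.

Variable T : finType.
Implicit Types M S : point_block T.

Definition is_simplex S : Prop :=
  (forall p, p \in points S -> #|[set k in blocks S | p \notin k]| = 1) /\
  (forall k, k \in blocks S -> #|[set p in points S | p \notin k]| = 1).

Definition inscribed S S' : Prop :=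
  (forall p, p \in points S -> #|[set k in blocks S' | p \in k]| = 1) /\
  (forall k, k \in blocks S -> #|[set p in points S' | p \in k]| = 1).

Definition split_in_halves (U : finType) (n : nat) (X X1 X2 : {set U}) : Prop :=
  [/\ X1 :|: X2 = X, [disjoint X1 & X2], #|X1| = n & #|X2| = n].

Definition decomposition (n : nat) M S1 S2 : Prop :=
  [/\ split_in_halves n (points M) (points S1) (points S2),
      split_in_halves n (blocks M) (blocks S1) (blocks S2),
      is_simplex S1 /\ is_simplex S2
    & inscribed S1 S2 /\ inscribed S2 S1].

End Decomposition.

Definition special_decomposition (T : finType) (n : nat) (phi : 'S_n)
    (a b : 'I_n -> T) (S1 S2 : point_block T) : Prop :=
  [/\ decomposition n (moebius_pair phi a b) S1 S2,
      S1 <> simplexA a b /\ S1 <> simplexB phi a b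
    & S2 <> simplexA a b /\ S2 <> simplexB phi a b].

(* Main.v *)
(** Let [X] and [Y] be the index sets of the points of [A] and of [B] in the
first simplex, so that [|X| + |Y| = n].  The block [A_i] meets the first simplex
in [|X| - [i \in X] + [i \in Y]] points, which must be [n - 1] or [1] according
to the part that contains [A_i].  If [|X| >= 3] the value [1] is impossible, all
the [A_i] lie in the first part, and counting forces [X = I]; the same applies to
the complement of [X].  What remains is [n = 4], [|X| = 2], where the counts for
[A_i] and [B_i] force [Y = ~: X] and [phi i \in X <-> i \in X].  Conversely such
an [X] gives the simplex on [{a_i | i \in X}] and [{b_i | i \notin X}] with blocks
[{A_i | i \notin X}] and [{B_i | i \in X}]. *)

Require Import Defs.
From mathcomp Require Import all_boot all_fingroup.
From mathcomp Require Import zify.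

Set Implicit Arguments.
Unset Strict Implicit.
Unset Printing Implicit Defensive.

(** * Unions of images under two injections with disjoint ranges *)

Lemma imset_setT (I U : finType) (f : I -> U) : f @: setT = [set f i | i : I].
Proof. by apply/setP=> u; apply/imsetP/imsetP => -[i _ ->]; exists i. Qed.

Section TwoFamilies.

Variables (I U : finType) (f g : I -> U).
Hypotheses (f_inj : injective f) (g_inj : injective g).
Hypothesis fg_neq : forall i j, f i != g j.

Lemma mem_imsetU_l (X Y : {set I}) i : (f i \in f @: X :|: g @: Y) = (i \in X).
Proof.
rewrite inE mem_imset // orbC; case: imsetP => // -[j _ fg].
by have := fg_neq i j; rewrite fg eqxx.
Qed.

Lemma mem_imsetU_r (X Y : {set I}) i : (g i \in f @: X :|: g @: Y) = (i \in Y).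
Proof.
rewrite inE orbC mem_imset // orbC; case: imsetP => // -[j _ fg].
by have := fg_neq j i; rewrite fg eqxx.
Qed.

Lemma imsetU_disjoint (X Y : {set I}) : [disjoint f @: X & g @: Y].
Proof.
apply/pred0P => u /=; apply/negbTE/andP => -[/imsetP[i _ ->] /imsetP[j _ fg]].
by have := fg_neq i j; rewrite fg eqxx.
Qed.

Lemma card_imsetU (X Y : {set I}) : #|f @: X :|: g @: Y| = #|X| + #|Y|.
Proof.
by rewrite cardsU (disjoint_setI0 (imsetU_disjoint X Y)) cards0 subn0 !card_imset.
Qed.

(** Reduces every incidence count to counts of indices: with [a], [b] for the points on a block,
    with [A], [B] for the blocks through a point. *)
Lemma card_imsetU_pred (X Y : {set I}) (Q : pred U) :
  #|[set u in f @: X :|: g @: Y | Q u]| =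
  #|[set i in X | Q (f i)]| + #|[set i in Y | Q (g i)]|.
Proof.
rewrite -card_imsetU; congr #|pred_of_set _|; apply/setP=> u; rewrite !inE.
apply/andP/orP => [[/orP[]/imsetP[i iX ->] Qu]|[]/imsetP[i]].
- by left; apply: imset_f; rewrite inE iX.
- by right; apply: imset_f; rewrite inE iX.
- by rewrite inE => /andP[iX Qi] ->; rewrite imset_f.
- by rewrite inE => /andP[iX Qi] ->; rewrite (imset_f g iX) orbT.
Qed.

(** Encodes an arbitrary set of points by two index sets, one for each family. *)
Lemma imsetU_preim (Z : {set U}) :
  Z \subset f @: setT :|: g @: setT -> Z = f @: (f @^-1: Z) :|: g @: (g @^-1: Z).
Proof.
move=> /subsetP sZ; apply/setP=> u; rewrite inE; apply/idP/orP => [uZ|].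
  have := sZ _ uZ; rewrite inE => /orP[]/imsetP[i _ ui]; [left|right].
    by rewrite ui imset_f // inE -ui.
  by rewrite ui imset_f // inE -ui.
by case=> /imsetP[i]; rewrite inE => iZ ->.
Qed.

Lemma imsetUC_split (X Y : {set I}) m :
  #|X| + #|Y| = m -> #|~: X| + #|~: Y| = m ->
  split_in_halves m (f @: setT :|: g @: setT)
    (f @: X :|: g @: Y) (f @: (~: X) :|: g @: (~: Y)).
Proof.
move=> cXY cXYC; split; rewrite ?card_imsetU //.
  by rewrite setUACA -(imsetU f) -(imsetU g) !setUCr.
apply/pred0P => u /=; apply/negbTE/andP => -[].
rewrite [u \in _]inE => /orP[]/imsetP[i iX ->].
  by rewrite mem_imsetU_l inE iX.
by rewrite mem_imsetU_r inE iX.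
Qed.

End TwoFamilies.

(** * Elementary counts and the exchange of the two simplices *)

Lemma card_set_predC (T : finType) (D : {set T}) (Q : pred T) :
  #|[set x in D | Q x]| + #|[set x in D | ~~ Q x]| = #|D|.
Proof.
rewrite -(cardsID [set x | Q x] D); congr (_ + _);
  by apply: eq_card => x; rewrite !inE // andbC.
Qed.

Lemma card_set_neq (I : finType) (X : {set I}) i :
  #|[set j in X | j != i]| = #|X| - (i \in X).
Proof.
rewrite (cardsD1 i X) addKn; apply: eq_card => j; by rewrite !inE andbC.
Qed.

Lemma card_set_eq (I : finType) (X : {set I}) i :
  #|[set j in X | j == i]| = (i \in X).
Proof.
have := card_set_predC X (pred1 i); rewrite card_set_neq /=.
by have := cardsD1 i X; case: (i \in X); lia.
Qed.

Lemma decompositionC (T : finType) n (M S1 S2 : point_block T) :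
  decomposition n M S1 S2 -> decomposition n M S2 S1.
Proof.
move=> [[pU pD p1 p2] [kU kD k1 k2] [s1 s2] [i1 i2]].
by split; split=> //; rewrite 1?setUC 1?disjoint_sym.
Qed.

(** * Incidence in the Moebius pair *)

Section Moebius.

Variables (T : finType) (n : nat) (phi : 'S_n) (a b : 'I_n -> T).
Hypotheses (a_inj : injective a) (b_inj : injective b).
Hypothesis disjAB : [disjoint pointsA a & pointsB b].

Let A := blockA a b.
Let B := blockB phi a b.

Lemma a_neq_b i j : a i != b j.
Proof.
apply/eqP => ab; have /pred0P/(_ (a i)) /= := disjAB.
by rewrite {2}ab !imset_f.
Qed.

Lemma mem_a_blockA i j : (a j \in A i) = (j != i).
Proof.
rewrite !inE (negbTE (a_neq_b _ _)) orbF (inj_eq a_inj) imset_f //.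
by rewrite andbT.
Qed.

Lemma mem_b_pointsA j : b j \in pointsA a = false.
Proof.
by apply/imsetP => -[i _ ba]; have := a_neq_b i j; rewrite ba eqxx.
Qed.

Lemma mem_b_blockA i j : (b j \in A i) = (j == i).
Proof. by rewrite !inE mem_b_pointsA andbF (inj_eq b_inj). Qed.

Lemma mem_b_blockB i j : (b j \in B i) = (j != i).
Proof.
rewrite !inE [b j == a _]eq_sym (negbTE (a_neq_b _ _)) orbF (inj_eq b_inj).
by rewrite imset_f // andbT.
Qed.

Lemma mem_a_pointsB j : a j \in pointsB b = false.
Proof.
by apply/imsetP => -[i _ ab]; have := a_neq_b j i; rewrite ab eqxx.
Qed.

Lemma mem_a_blockB i j : (a j \in B i) = (j == phi i).
Proof. by rewrite !inE mem_a_pointsB andbF (inj_eq a_inj). Qed.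

Definition mem_blocks := (mem_a_blockA, mem_b_blockA, mem_a_blockB, mem_b_blockB).

(** The only [b j] on [A i] is [b i], so this one foreign point recovers the index; for [B i] the
    foreign point is [a (phi i)]. *)
Lemma blockA_inj : injective A.
Proof. by move=> i j Aij; apply/eqP; rewrite -mem_b_blockA -Aij mem_b_blockA. Qed.

Lemma blockB_inj : injective B.
Proof.
move=> i j Bij; apply/eqP; rewrite -(inj_eq (@perm_inj _ phi)).
by rewrite -mem_a_blockB -Bij mem_a_blockB.
Qed.

(** As [n] is at least 3, some [l] differs from both [i] and [j]; then [b l] lies on [B j] but not
    on [A i]. *)
Lemma blockA_neq_blockB : 3 <= n -> forall i j, A i != B j.
Proof.
move=> n_ge3 i j; apply/eqP => AB.
have : 0 < #|~: [set i; j]| by have := cards2 i j; have := cardsC [set i; j];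
  rewrite card_ord; case: (i != j) => /=; lia.
case/card_gt0P => l; rewrite !inE negb_or => /andP[/negbTE li lj].
by have := mem_b_blockA i l; rewrite AB mem_b_blockB li lj.
Qed.

Lemma pointsM : points (moebius_pair phi a b) = a @: setT :|: b @: setT.
Proof. by rewrite !imset_setT. Qed.

Lemma blocksM : blocks (moebius_pair phi a b) = A @: setT :|: B @: setT.
Proof. by rewrite !imset_setT. Qed.

Lemma card_points_blockA (Z W : {set 'I_n}) i :
  #|[set p in a @: Z :|: b @: W | p \in A i]| = #|Z| - (i \in Z) + (i \in W).
Proof.
rewrite (card_imsetU_pred a_inj b_inj a_neq_b Z W (fun p => p \in A i)).
rewrite -card_set_neq -(card_set_eq W).
by congr (_ + _); apply: eq_card => j; rewrite [LHS]inE mem_blocks [RHS]inE.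
Qed.

Lemma card_points_blockB (Z W : {set 'I_n}) i :
  #|[set p in a @: Z :|: b @: W | p \in B i]| =
  (phi i \in Z) + (#|W| - (i \in W)).
Proof.
rewrite (card_imsetU_pred a_inj b_inj a_neq_b Z W (fun p => p \in B i)).
rewrite -card_set_neq -(card_set_eq Z).
by congr (_ + _); apply: eq_card => j; rewrite [LHS]inE mem_blocks [RHS]inE.
Qed.

(** * Constraints on the index sets of an arbitrary decomposition *)

Section Decomposed.

Variables S1 S2 : point_block T.
Hypothesis dec : decomposition n (moebius_pair phi a b) S1 S2.

Let X := a @^-1: points S1.
Let Y := b @^-1: points S1.

Lemma points_preim : points S1 = a @: X :|: b @: Y.
Proof.
apply: imsetU_preim; case: dec => -[pU _ _ _] _ _ _.
by rewrite -pointsM -pU subsetUl.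
Qed.

Lemma card_preim : #|X| + #|Y| = n.
Proof.
rewrite -(card_imsetU a_inj b_inj a_neq_b) -points_preim.
by case: dec => -[].
Qed.

Lemma preimC : a @^-1: points S2 = ~: X.
Proof.
case: dec => -[pU pD _ _] _ _ _; apply/setP => i; rewrite !inE.
have aM : a i \in points S1 :|: points S2.
  by rewrite pU pointsM inE imset_f.
case a1 : (a i \in points S1); first by rewrite (disjointFr pD a1).
by move: aM; rewrite inE a1.
Qed.

(** A block of [S1] misses exactly one of the [n] points of [S1]; a block of [S2] meets [points S1]
    once because the simplices are mutually inscribed. *)
Lemma block_mem k : k \in blocks (moebius_pair phi a b) ->
  k \in blocks S1 /\ #|[set p in points S1 | p \in k]| = n.-1 \/
  k \in blocks S2 /\ #|[set p in points S1 | p \in k]| = 1.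
Proof.
case: dec => -[pU pD p1 p2] [<- kD k1 k2] [[_ s1] _] [_ [_ i2]].
rewrite inE => /orP[k_1|k_2]; [left|right]; split=> //; last exact: i2.
have := card_set_predC (points S1) (fun p => p \in k).
by rewrite p1 (s1 _ k_1) addn1 => <-.
Qed.

Lemma blockA_cases i :
  A i \in blocks S1 /\ #|X| - (i \in X) + (i \in Y) = n.-1 \/
  A i \in blocks S2 /\ #|X| - (i \in X) + (i \in Y) = 1.
Proof.
rewrite -card_points_blockA -points_preim; apply: block_mem.
by rewrite blocksM inE imset_f.
Qed.

Lemma blockB_cases i :
  (phi i \in X) + (#|Y| - (i \in Y)) = n.-1 \/
  (phi i \in X) + (#|Y| - (i \in Y)) = 1.
Proof.
rewrite -card_points_blockB -points_preim.
have BM : B i \in blocks (moebius_pair phi a b).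
  by rewrite blocksM inE orbC imset_f.
by case: (block_mem BM) => -[_ ->]; [left|right].
Qed.

Lemma large_preim_simplexA : 3 <= #|X| -> S1 = simplexA a b.
Proof.
move=> X_ge3.
have memA i : A i \in blocks S1 /\ #|X| - (i \in X) + (i \in Y) = n.-1.
  (* The value 1 is excluded since [#|X| - (i \in X)] is already at least 2. *)
  by case: (blockA_cases i) => // -[_]; case: (i \in X); lia.
(* The [n] distinct blocks [A i] all lie in a set of [n] blocks, so they exhaust it. *)
have eqK : blocksA a b = blocks S1.
  apply/eqP; rewrite eqEcard; apply/andP; split.
    by apply/subsetP => k /imsetP[i _ ->]; case: (memA i).
  rewrite (card_imset _ blockA_inj) card_ord.
  by case: dec => _ [_ _ -> _].
have cXY := card_preim.
(* Otherwise [#|X| <= #|Y|]; but the count for any [A i] gives [#|X| >= n - 2], so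
   [#|Y| <= 2 < #|X|]. *)
have [j jX jY] : exists2 j, j \in X & j \notin Y.
  apply/subsetPn; apply/negP => /subset_leq_card.
  have /card_gt0P[i _] : 0 < #|X| by lia.
  by case: (memA i) => _; case: (i \in X); case: (i \in Y); lia.
(* For this [j] the count reads [#|X| - 1 = n - 1], which forces [#|X| = n] and leaves nothing for
   [Y]. *)
have [_] := memA j; rewrite jX (negbTE jY) => Xn.
have Y0 : Y = set0 by apply/eqP; rewrite -cards_eq0; lia.
have XT : X = setT.
  by apply/eqP; rewrite eqEcard subsetT cardsT card_ord; lia.
have eqP1 : pointsA a = points S1.
  by rewrite points_preim XT Y0 imset0 setU0 imset_setT.
by rewrite /simplexA eqP1 eqK; case: (S1).
Qed.

Lemma small_preim_stable : n = 4 -> #|X| = 2 -> phi @: X = X.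
Proof.
move=> n4 cX; have cXY := card_preim.
(* Since [phi] is injective, the inclusion of [phi @: X] in [X] suffices. *)
apply/eqP; rewrite eqEcard card_imset ?leqnn ?andbT; last exact: perm_inj.
apply/subsetP => _ /imsetP[i iX ->].
have cY : #|Y| = 2 by lia.
(* Here [A i] has [1 + (i \in Y)] points in [S1], and only 1 and 3 are allowed. *)
have /negbTE iY : i \notin Y.
  by case: (blockA_cases i) => -[_]; rewrite iX cX; case: (i \in Y) => //; lia.
(* Now [B i] has [(phi i \in X) + 2] points in [S1], so the value must be 3. *)
by case: (blockB_cases i); rewrite iY cY; case: (phi i \in X) => //; lia.
Qed.

End Decomposed.

(** * The special decomposition built from a stable pair of indices *)

Section Construction.

Hypothesis n_eq4 : n = 4.

(** The opposite simplex is [mixed_simplex (~: X)], so each property is proved once and applied to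
    both [X] and [~: X]. *)
Definition mixed_simplex (X : {set 'I_n}) : point_block T :=
  PointBlock (a @: X :|: b @: (~: X)) (A @: (~: X) :|: B @: X).

Let A_neq_B : forall i j, A i != B j.
Proof. by apply: blockA_neq_blockB; rewrite n_eq4. Qed.

Section Stable.

Variable X : {set 'I_n}.
Hypotheses (cX : #|X| = 2) (phiX : phi @: X = X).

Let cXC : #|~: X| = 2.
Proof. by have := cardsC X; rewrite card_ord cX; lia. Qed.

Let mem_phi i : (phi i \in X) = (i \in X).
Proof. by rewrite -{1}phiX mem_imset //; apply: perm_inj. Qed.

Let card_phi_eq (Z : {set 'I_n}) j :
  #|[set i in Z | j == phi i]| = (phi^-1%g j \in Z).
Proof.
rewrite -card_set_eq; apply: eq_card => i.
by rewrite !inE eq_sym (can2_eq (permK phi) (permKV phi)).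
Qed.

Let mem_phiV i : (phi^-1%g i \in X) = (i \in X).
Proof. by rewrite -mem_phi permKV. Qed.

Let blk (Z W : {set 'I_n}) (Q : pred {set T}) :=
  card_imsetU_pred blockA_inj blockB_inj A_neq_B Z W Q.

Lemma card_blocks_a (Z W : {set 'I_n}) j :
  #|[set k in A @: Z :|: B @: W | a j \in k]| =
  #|Z| - (j \in Z) + (phi^-1%g j \in W).
Proof.
rewrite (blk Z W (fun k => a j \in k)) -card_set_neq -card_phi_eq.
by congr (_ + _); apply: eq_card => i;
  rewrite [LHS]inE mem_blocks [RHS]inE // eq_sym.
Qed.

Lemma card_blocks_b (Z W : {set 'I_n}) j :
  #|[set k in A @: Z :|: B @: W | b j \in k]| =
  (j \in Z) + (#|W| - (j \in W)).
Proof.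
rewrite (blk Z W (fun k => b j \in k)) -card_set_neq -(card_set_eq Z).
by congr (_ + _); apply: eq_card => i;
  rewrite [LHS]inE mem_blocks [RHS]inE // eq_sym.
Qed.

Lemma card_mixed_points : #|points (mixed_simplex X)| = 4.
Proof. by rewrite (card_imsetU a_inj b_inj a_neq_b) cX cXC. Qed.

Lemma card_mixed_blocks : #|blocks (mixed_simplex X)| = 4.
Proof. by rewrite (card_imsetU blockA_inj blockB_inj A_neq_B) cX cXC. Qed.

Lemma mixed_is_simplex : is_simplex (mixed_simplex X).
Proof.
split=> [p pP|k kK].
  have := card_set_predC (blocks (mixed_simplex X)) (fun k => p \in k).
  rewrite card_mixed_blocks.
  (* Three incidences among four blocks leave exactly one miss: two blocks come from one family and
     one from the other. The dual count for points is the same. *)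
  suff -> : #|[set k in blocks (mixed_simplex X) | p \in k]| = 3 by lia.
  move: pP; rewrite /= inE => /orP[]/imsetP[j jX ->].
    by rewrite card_blocks_a cXC mem_phiV inE jX.
  rewrite card_blocks_b cX.
  by rewrite jX; move: jX; rewrite inE => /negbTE ->.
have := card_set_predC (points (mixed_simplex X)) (fun p => p \in k).
rewrite card_mixed_points.
suff -> : #|[set p in points (mixed_simplex X) | p \in k]| = 3 by lia.
move: kK; rewrite /= inE => /orP[]/imsetP[j jX ->].
  rewrite card_points_blockA cX.
  by rewrite jX; move: jX; rewrite inE => /negbTE ->.
by rewrite card_points_blockB cXC mem_phi inE jX.
Qed.

Lemma mixed_inscribed : inscribed (mixed_simplex X) (mixed_simplex (~: X)).
Proof.
split=> [p|k]; rewrite inE => /orP[]/imsetP[j jX ->] /=; rewrite setCK.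
- by rewrite card_blocks_a inE mem_phiV cX jX.
- by rewrite card_blocks_b cXC jX; move: jX; rewrite inE => /negbTE ->.
- by rewrite card_points_blockA cXC jX; move: jX; rewrite inE => /negbTE ->.
- by rewrite card_points_blockB inE mem_phi cX jX.
Qed.

Lemma mixed_neq :
  mixed_simplex X <> simplexA a b /\ mixed_simplex X <> simplexB phi a b.
Proof.
have /card_gt0P[i iX] : 0 < #|X| by rewrite cX.
have /card_gt0P[j jX] : 0 < #|~: X| by rewrite cXC.
(* The mixed simplex contains some [b j] and some [a i], whereas each standard simplex has points of
   one kind only. *)
split=> /(congr1 (@points T)) /= /setP.
  move/(_ (b j)); rewrite (mem_imsetU_r b_inj a_neq_b) jX.
  by rewrite mem_b_pointsA.
move/(_ (a i)); rewrite (mem_imsetU_l a_inj a_neq_b) iX.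
by rewrite mem_a_pointsB.
Qed.

End Stable.

Lemma mixed_special (X : {set 'I_n}) : #|X| = 2 -> phi @: X = X ->
  special_decomposition phi a b (mixed_simplex X) (mixed_simplex (~: X)).
Proof.
move=> cX phiX.
have cXC : #|~: X| = 2 by have := cardsC X; rewrite card_ord cX; lia.
have phiXC : phi @: (~: X) = ~: X.
  by rewrite -preim_permV preimsetC preim_permV phiX.
have n22 : 2 + 2 = n by rewrite n_eq4.
split; [split|exact: mixed_neq..].
- rewrite pointsM.
  by apply: (imsetUC_split a_inj b_inj a_neq_b); rewrite ?setCK ?cX cXC.
- rewrite blocksM.
  by apply: (imsetUC_split blockA_inj blockB_inj A_neq_B); rewrite ?setCK ?cX cXC.
- by split; apply: mixed_is_simplex.
- split; first exact: mixed_inscribed.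
  (* Writing the second [X] as [~: ~: X] turns the converse inscription into the same lemma for
     [~: X]. *)
  by rewrite -{2}[X]setCK; apply: mixed_inscribed.
Qed.

End Construction.

End Moebius.

Theorem proposition2p3 (T : finType) (n : nat) (phi : 'S_n) (a b : 'I_n -> T)
    (n_ge4 : 4 <= n) (a_inj : injective a) (b_inj : injective b)
    (disjAB : [disjoint pointsA a & pointsB b]) :
  (exists S1 S2 : point_block T, special_decomposition phi a b S1 S2) <->
  (n = 4 /\ exists X : {set 'I_n}, #|X| = 2 /\ phi @: X = X).
Proof.
split=> [[S1 [S2 [dec [S1A _] [S2A _]]]]|[n4 [X [cX phiX]]]].
  set X := a @^-1: points S1.
  have X_le2 : #|X| <= 2.
    by rewrite leqNgt; apply/negP => /(large_preim_simplexA a_inj b_inj disjAB dec).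
  (* [~: X] indexes the points of [A] in [S2], so the bound follows from the decomposition with its
     simplices exchanged. *)
  have XC_le2 : #|~: X| <= 2.
    rewrite -(preimC dec) leqNgt; apply/negP.
    by move/(large_preim_simplexA a_inj b_inj disjAB (decompositionC dec)).
  have := cardsC X; rewrite card_ord => cXC.
  (* Two sizes of at most 2 add up to [n >= 4], so both equal 2. *)
  have n4 : n = 4 by lia.
  have cX : #|X| = 2 by lia.
  by split=> //; exists X; split=> //; apply: small_preim_stable dec n4 cX.
exists (mixed_simplex phi a b X), (mixed_simplex phi a b (~: X)).
exact: mixed_special.
Qed.
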